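(* Asymmetric $R,\emptyset$-unification for one-sided distributivity is decidable: there is an algorithm that, given a finite set of asymmetric equations $\{s_1=^{\downarrow}t_1,\dots,s_n=^{\downarrow}t_n\}$ between terms built from $+$, $\times$ and variables, decides whether it has an asymmetric $R,\emptyset$-unifier.
   Context: Signature: binary symbols $+,\times$. $R=\{X\times(Y+Z)\to X\times Y+X\times Z\}$, $E=\emptyset$, and $\Delta$ is the equational theory generated by $X\times(Y+Z)=X\times Y+X\times Z$. $R$ is confluent and terminating; $t\downarrow$ denotes the $R$-normal form of $t$. A substitution $\delta$ is an asymmetric $R,\emptyset$-unifier of $\{s_1=^{\downarrow}t_1,\dots,s_n=^{\downarrow}t_n\}$ iff for each $i$, $\delta(s_i)=_\Delta\delta(t_i)$ and $(t_i\downarrow)\delta$ is in $R$-normal form. *)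

(* Defs.v *)
From mathcomp Require Import all_boot.
From Stdlib Require Import Relations.
From Stdlib Require List.

Set Implicit Arguments.
Unset Strict Implicit.
Unset Printing Implicit Defensive.

Inductive term : Type :=
  | Var (x : nat)
  | Add (s t : term)
  | Mul (s t : term).

(* [X * (Y + Z) -> X * Y + X * Z], closed under substitutions (the root rule is
   stated for arbitrary [x], [y], [z]) and under contexts. *)
Inductive step : term -> term -> Prop :=
  | step_root x y z : step (Mul x (Add y z)) (Add (Mul x y) (Mul x z))
  | step_Add_l s s' t : step s s' -> step (Add s t) (Add s' t)
  | step_Add_r s t t' : step t t' -> step (Add s t) (Add s t')
  | step_Mul_l s s' t : step s s' -> step (Mul s t) (Mul s' t)
  | step_Mul_r s t t' : step t t' -> step (Mul s t) (Mul s t').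

Definition rewrites : term -> term -> Prop := clos_refl_trans term step.

Definition normal (t : term) : Prop := forall u, ~ step t u.

(* The relation [t↓ = u]; it is functional and total, see [normal_form_exists]
   and [normal_form_unique] below. *)
Definition normal_form_of (t u : term) : Prop := rewrites t u /\ normal u.

Inductive eqD : term -> term -> Prop :=
  | eqD_ax x y z : eqD (Mul x (Add y z)) (Add (Mul x y) (Mul x z))
  | eqD_refl t : eqD t t
  | eqD_sym s t : eqD s t -> eqD t s
  | eqD_trans s t u : eqD s t -> eqD t u -> eqD s u
  | eqD_Add s s' t t' : eqD s s' -> eqD t t' -> eqD (Add s t) (Add s' t')
  | eqD_Mul s s' t t' : eqD s s' -> eqD t t' -> eqD (Mul s t) (Mul s' t').

Fixpoint subst (d : nat -> term) (t : term) : term :=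
  match t with
  | Var x => d x
  | Add s t => Add (subst d s) (subst d t)
  | Mul s t => Mul (subst d s) (subst d t)
  end.

Definition substitution (d : nat -> term) : Prop :=
  exists dom : seq nat, forall x, x \notin dom -> d x = Var x.

(* The pair [(s, t)] stands for the asymmetric equation [s =↓ t]. *)
Definition problem : Type := seq (term * term).

Definition asym_unifier (d : nat -> term) (P : problem) : Prop :=
  forall s t, List.In (s, t) P ->
    eqD (subst d s) (subst d t) /\
    exists2 u, normal_form_of t u & normal (subst d u).

Definition asym_unifiable (P : problem) : Prop :=
  exists2 d, substitution d & asym_unifier d P.

Fixpoint distr (s t : term) : term :=
  if t is Add t1 t2 then Add (distr s t1) (distr s t2) else Mul s t.

Fixpoint nf (t : term) : term :=
  match t with
  | Var x => Var x
  | Add s t => Add (nf s) (nf t)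
  | Mul s t => distr (nf s) (nf t)
  end.

Lemma rewrites_ctx (f : term -> term) s t :
  (forall a b, step a b -> step (f a) (f b)) ->
  rewrites s t -> rewrites (f s) (f t).
Proof.
move=> Hf; elim=> [a b Hab|a|a b c _ Hab _ Hbc].
- exact/rt_step/Hf.
- exact: rt_refl.
- exact: rt_trans Hab Hbc.
Qed.

Lemma rewrites_Add s s' t t' :
  rewrites s s' -> rewrites t t' -> rewrites (Add s t) (Add s' t').
Proof.
move=> Hs Ht; apply: (rt_trans _ _ _ (Add s' t)).
  by apply: (rewrites_ctx (f := Add^~ t)) Hs => a b; exact: step_Add_l.
by apply: rewrites_ctx Ht => a b; exact: step_Add_r.
Qed.

Lemma rewrites_Mul s s' t t' :
  rewrites s s' -> rewrites t t' -> rewrites (Mul s t) (Mul s' t').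
Proof.
move=> Hs Ht; apply: (rt_trans _ _ _ (Mul s' t)).
  by apply: (rewrites_ctx (f := Mul^~ t)) Hs => a b; exact: step_Mul_l.
by apply: rewrites_ctx Ht => a b; exact: step_Mul_r.
Qed.

Lemma rewrites_distr s t : rewrites (Mul s t) (distr s t).
Proof.
elim: t => [x|t1 IH1 t2 IH2|t1 _ t2 _] /=; try exact: rt_refl.
apply: rt_trans; first exact/rt_step/step_root.
exact: rewrites_Add.
Qed.

Lemma rewrites_nf t : rewrites t (nf t).
Proof.
elim: t => [x|s IHs t IHt|s IHs t IHt] /=; first exact: rt_refl.
  exact: rewrites_Add.
exact: rt_trans (rewrites_Mul IHs IHt) (rewrites_distr _ _).
Qed.

Lemma normal_Add s t : normal s -> normal t -> normal (Add s t).
Proof. by move=> Hs Ht u H; inversion H; subst; [apply: Hs|apply: Ht]; eauto. Qed.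

Lemma normal_AddE s t : normal (Add s t) -> normal s /\ normal t.
Proof.
by move=> H; split=> u Hu; apply: H; [apply: step_Add_l|apply: step_Add_r]; eauto.
Qed.

Lemma normal_MulE s t : normal (Mul s t) -> normal s /\ normal t.
Proof.
by move=> H; split=> u Hu; apply: H; [apply: step_Mul_l|apply: step_Mul_r]; eauto.
Qed.

Lemma normal_distr s t : normal s -> normal t -> normal (distr s t).
Proof.
move=> Hs; elim: t => [x|t1 IH1 t2 IH2|t1 _ t2 _] /= Ht.
- by move=> u H; inversion H as [| | |? s' ? H'|? ? ? H']; [exact: (Hs s')|inversion H'].
- by case: (normal_AddE Ht) => H1 H2; apply: normal_Add; auto.
- by move=> u H; inversion H as [| | |? s' ? H'|? ? t' H'];
    [exact: (Hs s')|exact: (Ht t')].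
Qed.

Lemma normal_nf t : normal (nf t).
Proof.
elim: t => [x|s IHs t IHt|s IHs t IHt] /=; first by move=> u H; inversion H.
  exact: normal_Add.
exact: normal_distr.
Qed.

Lemma nf_step s t : step s t -> nf s = nf t.
Proof. by elim=> //= {s t} s s' t _ ->. Qed.

Lemma nf_rewrites s t : rewrites s t -> nf s = nf t.
Proof. by elim=> [a b /nf_step //|//|a b c _ -> _ ->]. Qed.

Lemma nf_normal t : normal t -> nf t = t.
Proof.
elim: t => [//|s IHs t IHt|s IHs t IHt] H /=.
  by have [Hs Ht] := normal_AddE H; rewrite IHs ?IHt.
have [Hs Ht] := normal_MulE H; rewrite IHs ?IHt //.
by case: t H {IHt Ht} => //= t1 t2 /(_ _ (step_root _ _ _)).
Qed.

Lemma normal_form_exists t : normal_form_of t (nf t).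
Proof. by split; [exact: rewrites_nf|exact: normal_nf]. Qed.

Lemma normal_form_unique t u : normal_form_of t u -> u = nf t.
Proof. by case=> /nf_rewrites -> /nf_normal ->. Qed.

(* Algorithms are closed terms of the weak call-by-value lambda calculus L
   (Forster and Smolka, ITP 2017), a Turing-complete model, with de Bruijn
   indices. A model of computation has to be fixed: a decision "procedure" that
   is merely a Rocq function into [bool] exists for every predicate once the
   classical choice axioms are assumed. *)
Inductive ltm : Type :=
  | lvar (n : nat)
  | lapp (s t : ltm)
  | llam (s : ltm).

(* Nothing is shifted under binders: only closed terms are ever substituted. *)
Fixpoint lsubst (s : ltm) (k : nat) (u : ltm) : ltm :=
  match s with
  | lvar n => if n == k then u else lvar n
  | lapp s t => lapp (lsubst s k u) (lsubst t k u)
  | llam s => llam (lsubst s k.+1 u)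
  end.

Fixpoint lbound (k : nat) (s : ltm) : bool :=
  match s with
  | lvar n => n < k
  | lapp s t => lbound k s && lbound k t
  | llam s => lbound k.+1 s
  end.

Definition lclosed (s : ltm) : bool := lbound 0 s.

Inductive leval : ltm -> ltm -> Prop :=
  | leval_lam s : leval (llam s) (llam s)
  | leval_app s t s' v u :
      leval s (llam s') -> leval t v -> leval (lsubst s' 0 v) u ->
      leval (lapp s t) u.

(* Scott encodings: a value of a datatype with [n] constructors is a function of
   [n] continuations that passes the encoded arguments to the matching one. *)
Definition enc_bool (b : bool) : ltm :=
  llam (llam (lvar (if b then 1 else 0))).

Fixpoint enc_nat (n : nat) : ltm :=
  match n with
  | 0 => llam (llam (lvar 1))
  | n'.+1 => llam (llam (lapp (lvar 0) (enc_nat n')))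
  end.

Fixpoint enc_term (t : term) : ltm :=
  match t with
  | Var x => llam (llam (llam (lapp (lvar 2) (enc_nat x))))
  | Add s t =>
      llam (llam (llam (lapp (lapp (lvar 1) (enc_term s)) (enc_term t))))
  | Mul s t =>
      llam (llam (llam (lapp (lapp (lvar 0) (enc_term s)) (enc_term t))))
  end.

Definition enc_equation (e : term * term) : ltm :=
  llam (lapp (lapp (lvar 0) (enc_term e.1)) (enc_term e.2)).

Fixpoint enc_problem (P : problem) : ltm :=
  match P with
  | [::] => llam (llam (lvar 1))
  | e :: P' => llam (llam (lapp (lapp (lvar 0) (enc_equation e)) (enc_problem P')))
  end.

Definition decidable_by_algorithm (A : Type) (enc : A -> ltm) (Q : A -> Prop) : Prop :=
  exists2 u : ltm, lclosed u &
    forall x : A, exists b : bool,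
      leval (lapp u (enc x)) (enc_bool b) /\ (b = true <-> Q x).

(* Main.v *)
(* If a problem has a unifier [d], it has one of bounded depth, so that unifiability is
   decided by trying finitely many substitutions. Write [v q] for the normal form of
   [d q], where [q] ranges over the [n] subterms of the problem, and view a normal form
   as a binary tree of sums whose leaves are variables or products: [v (a * b)] is the
   tree [v b] with every leaf multiplied by [v a], so it has as many leaves as [v b].
   Shrink all values at once. A sum is kept if its number of leaves is that of some [v q],
   and is otherwise replaced by its leftmost leaf: this commutes with the equations,
   and on a branch the number of leaves decreases, so at most [n] nested sums survive
   and each [v q] keeps at most [2 ^ n] leaves. A product is kept if its size is that of
   one of these at most [n * 2 ^ n] kept leaves, and is otherwise replaced by a single
   variable. Leaves stay non-sums, so the normality constraints survive. *)

From HB Require Import structures.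
From mathcomp Require Import all_boot zify.
From Stdlib Require Import FunctionalExtensionality.
Require Import Defs.

Set Implicit Arguments.
Unset Strict Implicit.
Unset Printing Implicit Defensive.

(** * Terms *)

Fixpoint eqterm (s t : term) : bool :=
  match s, t with
  | Var x, Var y => eqn x y
  | Add s1 s2, Add t1 t2 | Mul s1 s2, Mul t1 t2 => eqterm s1 t1 && eqterm s2 t2
  | _, _ => false
  end.

Lemma eqtermP : Equality.axiom eqterm.
Proof.
move=> s t; apply: (iffP idP) => [|->]; last first.
  by elim: t => [x|t1 /= -> t2 ->|t1 /= -> t2 ->] //=; apply/eqP.
by elim: s t => [x|s1 IH1 s2 IH2|s1 IH1 s2 IH2] [y|t1 t2|t1 t2] //=;
  [move/eqP->|case/andP=> /IH1-> /IH2->|case/andP=> /IH1-> /IH2->].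
Qed.

HB.instance Definition _ := hasDecEq.Build term eqtermP.

Lemma InP (T : eqType) (x : T) (s : seq T) : reflect (List.In x s) (x \in s).
Proof.
elim: s => [|y s IH] /=; first by constructor.
rewrite in_cons eq_sym; apply: (iffP orP) => -[].
- by move/eqP; left.
- by move/IH; right.
- by move=> ->; left.
- by move/IH; right.
Qed.

Lemma eqD_rewrites s t : rewrites s t -> eqD s t.
Proof.
elim=> [a b|a|a b c _ Hab _]; [|exact: eqD_refl|exact: eqD_trans].
by elim=> *; [exact: eqD_ax|apply: eqD_Add|apply: eqD_Add|apply: eqD_Mul|apply: eqD_Mul];
  rewrite //; exact: eqD_refl.
Qed.

(** [nf] sends both sides of the axiom to the same term by computation and respects contexts;
    conversely every term equals its [nf] modulo the axiom. *)
Lemma eqD_nf s t : eqD s t <-> nf s = nf t.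
Proof.
split=> [|E]; first by elim=> //= [? ? ? _ -> _ ->|? ? ? ? _ -> _ ->|? ? ? ? _ -> _ ->].
apply: eqD_trans (eqD_rewrites (rewrites_nf s)) _.
by rewrite E; apply/eqD_sym/eqD_rewrites/rewrites_nf.
Qed.

Lemma normal_nfE t : normal t <-> nf t = t.
Proof. by split=> [/nf_normal|<-] //; exact: normal_nf. Qed.

Lemma nf_subst_nf d q : nf (subst (nf \o d) q) = nf (subst d q).
Proof.
by elim: q => [x|s /= -> t ->|s /= -> t ->] //=; apply/nf_normal/normal_nf.
Qed.

(** Both conditions become boolean tests: equality modulo distributivity is equality of normal
    forms, and normality is being a fixed point of [nf]. *)
Definition solves (d : nat -> term) (e : term * term) : bool :=
  eqterm (nf (subst d e.1)) (nf (subst d e.2)) &&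
  eqterm (nf (subst d (nf e.2))) (subst d (nf e.2)).

Lemma asym_unifierP d (P : problem) : asym_unifier d P <-> all (solves d) P.
Proof.
split=> [H|/allP H s t /InP /H /andP[/eqtermP E /eqtermP N]].
  apply/allP => -[s t] /InP /H [/eqD_nf E [u /normal_form_unique -> /nf_normal N]].
  by rewrite /solves /= E N; apply/andP; split; apply/eqtermP.
split; first exact/eqD_nf.
by exists (nf t); [exact: normal_form_exists|apply/normal_nfE].
Qed.

(** * Shrinking solutions *)

(** A variable weighs one more than its index, so the size of a term exceeds the index of each of
    its variables. *)
Fixpoint term_size (t : term) : nat :=
  match t with
  | Var x => x.+1
  | Add s t | Mul s t => (term_size s + term_size t).+1
  end.

Fixpoint leaves (t : term) : nat :=
  if t is Add s t then leaves s + leaves t else 1.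

Fixpoint leftmost (t : term) : term := if t is Add s _ then leftmost s else t.

(** These are the leaves, taken before shrinking, at which [shrink] continues below the sums; [G]
    will collect their sizes. *)
Fixpoint kept_leaves (F : seq nat) (t : term) : seq term :=
  match t with
  | Add t1 t2 =>
      if leaves t \in F then kept_leaves F t1 ++ kept_leaves F t2
      else [:: leftmost t1]
  | _ => [:: t]
  end.

(** Sums are tested by leaf count because multiplication on the left preserves it. Products are
    tested by size, which drops strictly on each branch. All variables collapse to [Var 0], so only
    finitely many results have a given depth. *)
Fixpoint shrink (F G : seq nat) (t : term) : term :=
  match t with
  | Var _ => Var 0
  | Add t1 t2 =>
      if leaves t \in F then Add (shrink F G t1) (shrink F G t2)
      else leftmost (shrink F G t1)
  | Mul t1 t2 =>
      if term_size t \in G then Mul (shrink F G t1) (shrink F G t2) else Var 0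
  end.

Definition is_add (t : term) : bool := if t is Add _ _ then true else false.

Lemma leaves_gt0 t : 0 < leaves t.
Proof. by elim: t => //= s Hs t Ht; rewrite addn_gt0 Hs. Qed.

Lemma distr_nadd s t : ~~ is_add t -> distr s t = Mul s t.
Proof. by case: t. Qed.

Lemma leaves_distr s t : leaves (distr s t) = leaves t.
Proof. by elim: t => //= t1 -> t2 ->. Qed.

Lemma leftmost_nadd t : ~~ is_add (leftmost t).
Proof. by elim: t. Qed.

Lemma leftmost_id t : ~~ is_add t -> leftmost t = t.
Proof. by case: t. Qed.

Lemma leftmost_distr s t : leftmost (distr s t) = Mul s (leftmost t).
Proof. by elim: t. Qed.

(** A left factor does not change leaf counts, so corresponding sums of [distr s t] and [t] are kept
    or collapsed together. *)
Lemma kept_leaves_distr F s t :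
  kept_leaves F (distr s t) = map (Mul s) (kept_leaves F t).
Proof.
elim: t => [//|t1 IH1 t2 IH2|//] /=.
by rewrite !leaves_distr; case: ifP => _; rewrite ?map_cat ?IH1 ?IH2 //= leftmost_distr.
Qed.

Lemma leftmost_normal t : normal t -> normal (leftmost t).
Proof. by elim: t => //= s IH t _ /normal_AddE[/IH]. Qed.

Lemma normal_nadd s t : normal (Mul s t) -> ~~ is_add t.
Proof. by case: t => // t1 t2 /(_ _ (step_root _ _ _)). Qed.

Section Shrink.

Variables F G : seq nat.
Local Notation H := (shrink F G).

Lemma shrink_nadd t : ~~ is_add t -> ~~ is_add (H t).
Proof. by case: t => //= s t _; case: ifP. Qed.

(** The only danger is a product whose right factor becomes a sum, and [shrink] turns non-sums into
    non-sums. *)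
Lemma shrink_normal t : normal t -> normal (H t).
Proof.
have nV : normal (Var 0) by move=> u Hu; inversion Hu.
elim: t => [//|s IHs t IHt|s IHs t IHt] Hst.
  have [Hs Ht] := normal_AddE Hst; rewrite /=; case: ifP => _.
    by apply: normal_Add; auto.
  by apply: leftmost_normal; auto.
have [Hs Ht] := normal_MulE Hst; rewrite [H _]/=; case: ifP => // _.
rewrite -distr_nadd; first by apply: normal_distr; auto.
exact/shrink_nadd/(normal_nadd Hst).
Qed.

(** This serves collapsed sums: only the leftmost leaf survives, so only that product must have its
    size in [G]. *)
Lemma leftmost_shrink_distr s t :
  term_size (Mul s (leftmost t)) \in G ->
  leftmost (H (distr s t)) = Mul (H s) (leftmost (H t)).
Proof.
elim: t => [x|t1 IH1 t2 _|t1 _ t2 _] Hin.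
- by move: Hin => /= ->.
- by rewrite /= !leaves_distr; case: ifP => _; rewrite /= ?(leftmost_id (leftmost_nadd _)) IH1.
- rewrite [distr _ _]/=.
  have -> : H (Mul s (Mul t1 t2)) = Mul (H s) (H (Mul t1 t2)).
    by move: Hin => /= ->.
  by rewrite [in RHS]leftmost_id ?shrink_nadd.
Qed.

(** Corresponding sums have equal leaf counts and share their fate; at each surviving leaf the
    product with [s] has its size in [G], so [shrink] keeps it and acts on its factors. *)
Lemma shrink_distr s t :
  {subset map term_size (kept_leaves F (distr s t)) <= G} ->
  H (distr s t) = distr (H s) (H t).
Proof.
rewrite kept_leaves_distr.
elim: t => [x|t1 IH1 t2 IH2|t1 _ t2 _] Hin.
- by have /= -> := Hin _ (mem_head _ _).
- move: Hin => /=; rewrite !leaves_distr; case: ifP => _ Hin /=.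
    rewrite !map_cat in Hin.
    by rewrite IH1 ?IH2 // => k Hk; apply: Hin; rewrite mem_cat Hk ?orbT.
  rewrite leftmost_shrink_distr; last exact: (Hin _ (mem_head _ _)).
  by rewrite distr_nadd // leftmost_nadd.
- have := Hin _ (mem_head _ _); rewrite [distr s _]/= => /= ->.
  by rewrite distr_nadd // (shrink_nadd (t := Mul t1 t2)).
Qed.

End Shrink.

(** * Shrinking applied to a solution *)

Fixpoint subterms (t : term) : seq term :=
  t :: match t with
       | Var _ => [::]
       | Add s t | Mul s t => subterms s ++ subterms t
       end.

Lemma size_subterms t : size (subterms t) <= term_size t.
Proof. by elim: t => //= s Hs t Ht; rewrite size_cat; lia. Qed.

Section Solution.

Variables (d : nat -> term) (F G : seq nat).
Hypothesis d_normal : forall x, normal (d x).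
Local Notation H := (shrink F G).

(** What [shrink] needs at one subterm: the first conjunct keeps the root when [q] is a sum, the
    second keeps the products when [q] is a product. *)
Definition covered (q : term) : bool :=
  let v := nf (subst d q) in
  (leaves v \in F) && all (mem G) (map term_size (kept_leaves F v)).

Lemma shrink_solution q :
  all covered (subterms q) -> nf (subst (H \o d) q) = H (nf (subst d q)).
Proof.
elim: q => [x _|s IHs t IHt|s IHs t IHt] /=.
- by rewrite (nf_normal (@d_normal x)); apply/nf_normal/shrink_normal/d_normal.
- rewrite all_cat => /and3P[/andP[/= HF _] /IHs-> /IHt->].
  by rewrite /= in HF; rewrite HF.
- rewrite all_cat => /and3P[/andP[_ /allP HG] /IHs-> /IHt->].
  by rewrite shrink_distr.
Qed.

(** A normal instance is its own value at every node of [u], so coverage makes [shrink] keep all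
    nodes of [u] and act only inside the values of its variables. *)
Lemma shrink_subst u :
  all covered (subterms u) -> normal (subst d u) ->
  subst (H \o d) u = H (subst d u).
Proof.
elim: u => [//|s IHs t IHt|s IHs t IHt] /=; rewrite all_cat => /and3P[C Cs Ct] N.
  have [Ns Nt] := normal_AddE N; rewrite IHs ?IHt //.
  by move: C => /andP[] /=; rewrite !nf_normal // => ->.
have [Ns Nt] := normal_MulE N; rewrite IHs ?IHt //.
move: C => /andP[_] /=; rewrite !nf_normal // distr_nadd ?(normal_nadd N) //=.
by rewrite andbT => ->.
Qed.

Lemma shrink_solves e :
  all covered (subterms e.1) -> all covered (subterms e.2) ->
  all covered (subterms (nf e.2)) -> solves d e -> solves (H \o d) e.
Proof.
case: e => s t /= Cs Ct Cu /andP[/eqtermP E /eqtermP/normal_nfE N].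
apply/andP; split; apply/eqtermP; first by rewrite !shrink_solution // E.
by apply/normal_nfE; rewrite shrink_subst //; exact: shrink_normal.
Qed.

End Solution.

(** * Size of the shrunk solution *)

Fixpoint small_terms (k : nat) : seq term :=
  if k is k'.+1 then
    let T := small_terms k' in
    Var 0 :: [seq Add a b | a <- T, b <- T] ++ [seq Mul a b | a <- T, b <- T]
  else [:: Var 0].

Lemma small_Var k : Var 0 \in small_terms k.
Proof. by case: k => [|k]; exact: mem_head. Qed.

Lemma small_Add k a b :
  (Add a b \in small_terms k.+1) = (a \in small_terms k) && (b \in small_terms k).
Proof.
rewrite [small_terms k.+1]/= in_cons mem_cat (_ : (Add a b == Var 0) = false) // orFb.
have -> : (Add a b \in [seq Mul a b | a <- small_terms k, b <- small_terms k]) = false.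
  by apply/allpairsP => -[[? ?] []].
rewrite orbF; apply/allpairsP/andP => [[[x y] [/= Hx Hy [-> ->]]] //|[Ha Hb]].
by exists (a, b).
Qed.

Lemma small_Mul k a b :
  (Mul a b \in small_terms k.+1) = (a \in small_terms k) && (b \in small_terms k).
Proof.
rewrite [small_terms k.+1]/= in_cons mem_cat (_ : (Mul a b == Var 0) = false) // orFb.
have -> : (Mul a b \in [seq Add a b | a <- small_terms k, b <- small_terms k]) = false.
  by apply/allpairsP => -[[? ?] []].
apply/allpairsP/andP => [[[x y] [/= Hx Hy [-> ->]]] //|[Ha Hb]].
by exists (a, b).
Qed.

Lemma small_terms_mono k m : k <= m -> {subset small_terms k <= small_terms m}.
Proof.
have small0 j t : t \in small_terms j -> (t == Var 0) || (0 < j).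
  by case: j => [|j]; rewrite ?orbT // inE => ->.
move=> le_km t; elim: t k m le_km => [x|s IHs t IHt|s IHs t IHt] k m le_km Ht.
- suff -> : Var x = Var 0 by exact: small_Var.
  case: k Ht {le_km} => [|k]; first by rewrite inE => /eqP.
  rewrite in_cons mem_cat => /or3P[/eqP|/allpairsP[[? ?] []]|/allpairsP[[? ?] []]] //.
- case: k m le_km Ht (small0 _ _ Ht) => [//|k] [//|m] km.
  by rewrite (small_Add k) (small_Add m) => /andP[/IHs-> // /IHt->].
- case: k m le_km Ht (small0 _ _ Ht) => [//|k] [//|m] km.
  by rewrite (small_Mul k) (small_Mul m) => /andP[/IHs-> // /IHt->].
Qed.

Lemma small_leftmost k t : t \in small_terms k -> leftmost t \in small_terms k.
Proof.
elim: t k => [//|s IHs t _|//] [//|k].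
rewrite small_Add => /andP[/IHs + _]; exact: small_terms_mono.
Qed.

Lemma count_leq_mono (s : seq nat) k m : k <= m -> count (geq k) s <= count (geq m) s.
Proof. by move=> km; apply: sub_count => x /= xk; exact: leq_trans km. Qed.

(** The entry [m] is counted on the right only. Such counts serve as ranks: they drop strictly from
    a kept node to its children. *)
Lemma count_leq_lt (s : seq nat) k m :
  m \in s -> k < m -> count (geq k) s < count (geq m) s.
Proof.
elim: s => //= x s IH; rewrite in_cons => /predU1P[<-|Hm] km.
  by rewrite leqnn (leqNgt m k) km add0n add1n ltnS count_leq_mono // ltnW.
rewrite -addnS leq_add ?IH //.
by case: (leqP x k) => // xk; rewrite (leq_trans xk (ltnW km)).
Qed.

(** Each summand of a kept sum has fewer leaves than the sum, whose leaf count lies in [F]; so the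
    exponent drops for both summands, which pays for adding their bounds. *)
Lemma size_kept_leaves F t :
  size (kept_leaves F t) <= 2 ^ count (geq (leaves t)) F.
Proof.
elim: t => [x|s IHs t IHt|s _ t _] /=; rewrite ?expn_gt0 //.
case: ifP => [Hin|_]; last by rewrite expn_gt0.
have [Ps Pt] := (leaves_gt0 s, leaves_gt0 t).
have L k : k < leaves s + leaves t ->
    2 ^ count (geq k) F <= 2 ^ (count (geq (leaves s + leaves t)) F).-1.
  by move=> Hk; rewrite leq_exp2l //; have := count_leq_lt Hin Hk; lia.
have C : 0 < count (geq (leaves s + leaves t)) F.
  by apply: leq_ltn_trans (leq0n _) (count_leq_lt Hin (_ : 0 < _)); lia.
rewrite size_cat -(prednK C) expnS mul2n -addnn.
by apply: leq_add; [apply: leq_trans IHs _|apply: leq_trans IHt _]; apply: L; lia.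
Qed.

(** The bound is a lexicographic rank in base [(size F).+1]: a kept product lowers the count over
    [G] and may reset the count over [F], while a kept sum lowers the count over [F] and does not
    raise the one over [G]. *)
Lemma shrink_small F G t :
  shrink F G t \in
    small_terms (count (geq (term_size t)) G * (size F).+1 + count (geq (leaves t)) F).
Proof.
elim: t => [x|s IHs t IHt|s IHs t IHt]; first exact: small_Var.
  have [Ps Pt] := (leaves_gt0 s, leaves_gt0 t).
  have Gs : count (geq (term_size s)) G <= count (geq (term_size (Add s t))) G.
    by apply: count_leq_mono => /=; lia.
  have Gt : count (geq (term_size t)) G <= count (geq (term_size (Add s t))) G.
    by apply: count_leq_mono => /=; lia.
  rewrite [shrink _ _ _]/=; case: ifP => [Hin|_].
    have Fs : count (geq (leaves s)) F < count (geq (leaves (Add s t))) F.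
      by apply: count_leq_lt => //=; lia.
    have Ft : count (geq (leaves t)) F < count (geq (leaves (Add s t))) F.
      by apply: count_leq_lt => //=; lia.
    rewrite -(prednK (leq_ltn_trans (leq0n _) Fs)) addnS small_Add.
    apply/andP; split; [apply: small_terms_mono IHs|apply: small_terms_mono IHt];
      by apply: leq_add; rewrite ?leq_mul2r ?Gs ?Gt ?orbT //; lia.
  apply: small_leftmost; apply: small_terms_mono IHs.
  by apply: leq_add; [rewrite leq_mul2r Gs orbT|apply: count_leq_mono => /=; lia].
rewrite [shrink _ _ _]/=; case: ifP => [Hin|_]; last exact: small_Var.
have Gs : count (geq (term_size s)) G < count (geq (term_size (Mul s t))) G.
  by apply: count_leq_lt => //=; lia.
have Gt : count (geq (term_size t)) G < count (geq (term_size (Mul s t))) G.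
  by apply: count_leq_lt => //=; lia.
have Fs := count_size (geq (leaves s)) F.
have Ft := count_size (geq (leaves t)) F.
(* One block of [(size F).+1] is split off: one unit pays for the product, the other [size F] for
   the reset count over [F]. *)
rewrite -(prednK (leq_ltn_trans (leq0n _) Gs)) mulSn addSn addSn small_Mul.
by apply/andP; split; [apply: small_terms_mono IHs|apply: small_terms_mono IHt]; nia.
Qed.

(** [nf e.2] enters because the normality condition concerns it, so its subterms must be covered as
    well. *)
Definition equation_size (e : term * term) : nat :=
  term_size e.1 + term_size e.2 + term_size (nf e.2).

Definition problem_size (P : problem) : nat :=
  foldr (fun e n => equation_size e + n) 0 P.

(** The bound of [shrink_small] for at most [n] entries in [F] and at most [n * 2 ^ n] in [G]. *)
Definition depth_bound (n : nat) : nat := n * 2 ^ n * n.+1 + n.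

Definition problem_subterms (P : problem) : seq term :=
  flatten [seq subterms e.1 ++ subterms e.2 ++ subterms (nf e.2) | e <- P].

Lemma size_problem_subterms P : size (problem_subterms P) <= problem_size P.
Proof.
elim: P => //= e P IH; rewrite size_cat leq_add // !size_cat addnA /equation_size.
by rewrite !leq_add ?size_subterms.
Qed.

Lemma size_flatten_leq T (ss : seq (seq T)) k :
  all (fun s => size s <= k) ss -> size (flatten ss) <= size ss * k.
Proof. by elim: ss => //= s ss IH /andP[Hs /IH]; rewrite size_cat mulSn; exact: leq_add. Qed.

Lemma small_solution d P :
  all (solves d) P ->
  exists2 d', all (solves d') P &
    forall x, d' x \in small_terms (depth_bound (problem_size P)).
Proof.
(* The substitution is normalized first, since shrinking acts on normal forms; [F] is fixed before
   [G] because the kept leaves depend on it. *)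
move=> Hd; pose d1 := nf \o d.
pose S := problem_subterms P.
pose F := [seq leaves (nf (subst d1 q)) | q <- S].
pose GG := [seq map term_size (kept_leaves F (nf (subst d1 q))) | q <- S].
pose G := flatten GG.
have Sn : size S <= problem_size P := size_problem_subterms P.
have Fn : size F <= problem_size P by rewrite size_map.
have Gn : size G <= problem_size P * 2 ^ problem_size P.
  apply: leq_trans (_ : size GG * 2 ^ problem_size P <= _).
    apply: size_flatten_leq; apply/allP => _ /mapP[q _ ->]; rewrite size_map.
    apply: leq_trans (size_kept_leaves _ _) _; rewrite leq_exp2l //.
    exact: leq_trans (count_size _ _) Fn.
  by rewrite size_map leq_mul2r Sn orbT.
have Cov (q : term) : q \in S -> covered d1 F G q.
  move=> Hq; apply/andP; split; first exact: map_f.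
  apply/allP => k Hk; apply/flattenP.
  exists (map term_size (kept_leaves F (nf (subst d1 q)))) => //.
  exact: (map_f (fun q => map term_size (kept_leaves F (nf (subst d1 q))))).
have d1n x : normal (d1 x) by exact: normal_nf.
have Hd1 : all (solves d1) P.
  apply: sub_all Hd => -[s t] /andP[/eqtermP E /eqtermP N]; apply/andP; split; apply/eqtermP.
    by rewrite !nf_subst_nf.
  rewrite nf_subst_nf N /=.
  (* Normality of the instance under [d] makes [d x] normal for each variable [x] of [nf t], so [d]
     and [d1] agree there. *)
  elim: (nf t) N => [x N|a IHa b IHb|a IHa b IHb].
    by rewrite /d1 /= [nf _]N.
    by move=> /normal_nfE/normal_AddE[/normal_nfE/IHa Ea /normal_nfE/IHb Eb]; rewrite /= Ea Eb.
  by move=> /normal_nfE/normal_MulE[/normal_nfE/IHa Ea /normal_nfE/IHb Eb]; rewrite /= Ea Eb.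
exists (shrink F G \o d1).
  apply/allP => e He.
  have Cov' q' : {subset subterms q' <= subterms e.1 ++ subterms e.2 ++ subterms (nf e.2)} ->
      all (covered d1 F G) (subterms q').
    by move=> Hq'; apply/allP => q Hq; apply: Cov; apply/flatten_mapP; exists e; auto.
  apply: (shrink_solves (@d1n)); last exact: (allP Hd1);
    by apply: Cov' => q Hq; rewrite !mem_cat Hq ?orbT.
move=> x; apply: small_terms_mono (shrink_small F G (d1 x)).
apply: leq_add; last exact: leq_trans (count_size _ _) Fn.
by apply: leq_mul => //; apply: leq_trans (count_size _ _) Gn.
Qed.

(** * The decision procedure *)

Fixpoint tuples (T : seq term) (n : nat) : seq (seq term) :=
  if n is n'.+1 then flatten [seq [seq t :: l | l <- tuples T n'] | t <- T]
  else [:: [::]].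

Lemma mem_tuples T l : {subset l <= T} -> l \in tuples T (size l).
Proof.
elim: l => //= t l IH Hl; apply/flatten_mapP; exists t; first exact/Hl/mem_head.
by apply: map_f; apply: IH => x Hx; apply: Hl; rewrite in_cons Hx orbT.
Qed.

(** The default [Var x] makes this the identity beyond the list, hence of finite support. *)
Definition seq_subst (l : seq term) (x : nat) : term := nth (Var x) l x.

Definition unifiable (P : problem) : bool :=
  let n := problem_size P in
  has (fun l => all (solves (seq_subst l)) P) (tuples (small_terms (depth_bound n)) n).

Lemma eq_subst d d' t :
  (forall x, x < term_size t -> d x = d' x) -> subst d t = subst d' t.
Proof.
elim: t => [x|s IHs t IHt|s IHs t IHt] /= E; first exact: E.
all: by rewrite IHs ?IHt // => x Hx; apply: E; lia.
Qed.

Lemma equation_size_leq e P : e \in P -> equation_size e <= problem_size P.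
Proof.
elim: P => //= e' P IH; rewrite in_cons => /predU1P[->|/IH]; first exact: leq_addr.
by move=> H; apply: leq_trans H (leq_addl _ _).
Qed.

Lemma unifiableP P : unifiable P <-> asym_unifiable P.
Proof.
split=> [/hasP[l _ Hl]|[d _ /asym_unifierP Hd]].
  exists (seq_subst l); last exact/asym_unifierP.
  exists (iota 0 (size l)) => x; rewrite mem_iota /= add0n -leqNgt => Hx.
  by rewrite /seq_subst nth_default.
have [d' Hd' small] := small_solution Hd.
(* Tabulating the first [n] values of [d'] suffices: every variable of the problem has index below
   [n]. *)
set n := problem_size P in small; pose l := [seq d' x | x <- iota 0 n].
have sl : size l = n by rewrite size_map size_iota.
apply/hasP; exists l.
  by rewrite -/n -{2}sl; apply: mem_tuples => _ /mapP[x _ ->].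
apply/allP => e He; have /andP[E N] := allP Hd' _ He.
have El x : x < equation_size e -> seq_subst l x = d' x.
  move=> Hx; have Hn : x < n := leq_trans Hx (equation_size_leq He).
  by rewrite /seq_subst (nth_map 0) ?size_iota // nth_iota.
rewrite /solves !(@eq_subst (seq_subst l) d'); first exact/andP.
all: by move=> x Hx; apply: El; rewrite /equation_size; lia.
Qed.
(** * Computability in the calculus L *)

Definition lvalue (s : ltm) : bool := if s is llam s' then lbound 1 s' else false.

Lemma lsubst_id s m k u : lbound m s -> m <= k -> lsubst s k u = s.
Proof.
elim: s m k => [n|s IHs t IHt|s IHs] m k /=.
- by move=> nm mk; rewrite ltn_eqF // (leq_trans nm mk).
- by case/andP=> Hs Ht mk; rewrite (IHs m) ?(IHt m).
- by move=> Hs mk; rewrite (IHs m.+1).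
Qed.

Lemma lbound_mono s m k : lbound m s -> m <= k -> lbound k s.
Proof.
elim: s m k => [n|s IHs t IHt|s IHs] m k /=; first exact: leq_trans.
  by case/andP=> /IHs Hs /IHt Ht mk; rewrite Hs ?Ht.
by move/IHs=> Hs mk; exact: Hs.
Qed.

Lemma lvalue_lbound s k : lvalue s -> lbound k s.
Proof. by case: s => //= s Hs; exact: lbound_mono Hs _. Qed.

Lemma lvalue_lsubst s k u : lvalue s -> lsubst s k u = s.
Proof. by move=> Hs; apply: (lsubst_id (m := 0)); rewrite ?lvalue_lbound. Qed.

Lemma leval_value s : lvalue s -> leval s s.
Proof. by case: s => // s _; exact: leval_lam. Qed.

Lemma leval_value_inv s v : lvalue s -> leval s v -> v = s.
Proof. by case: s => // s _ H; inversion H. Qed.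

(** Values evaluate only to themselves, so inverting the evaluation of [lapp vs vt] exposes its beta
    step, which then serves [lapp s t]. *)
Lemma leval_congr s t vs vt v :
  leval s vs -> leval t vt -> lvalue vs -> lvalue vt -> leval (lapp vs vt) v ->
  leval (lapp s t) v.
Proof.
move=> Hs Ht Vs Vt H; inversion H as [|? ? s' w ? Es Et E]; subst.
have Es' := leval_value_inv Vs Es; rewrite -Es' in Hs.
by apply: leval_app Hs _ E; rewrite (leval_value_inv Vt Et).
Qed.

Lemma leval_beta s v u :
  lvalue v -> leval (lsubst s 0 v) u -> leval (lapp (llam s) v) u.
Proof. by move=> Vv; apply: leval_app; [exact: leval_lam|exact: leval_value]. Qed.

(* A logical relation rather than an encoding function, so that higher-order
   functions such as [foldr] are realized too, and partial applications compose. *)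
Class represented (A : Type) := Represented {
  reprs : A -> ltm -> Prop;
  reprs_value : forall a t, reprs a t -> lvalue t
}.
Arguments reprs_value {A _ a t}.

Definition computable (A : Type) {RA : represented A} (a : A) : Prop :=
  exists t, reprs a t.

(** These are the Scott forms used by [enc_equation] and [enc_problem], so an encoded problem
    represents a sequence of pairs. *)
Definition lpair (s t : ltm) : ltm := llam (lapp (lapp (lvar 0) s) t).
Definition lnil : ltm := llam (llam (lvar 1)).
Definition lcons (s t : ltm) : ltm := llam (llam (lapp (lapp (lvar 0) s) t)).

Section Representations.

Variables (A B : Type).
Context {RA : represented A} {RB : represented B}.

Definition reprs_fun (f : A -> B) (t : ltm) : Prop :=
  lvalue t /\
  forall a ta, reprs a ta -> exists2 v, leval (lapp t ta) v & reprs (f a) v.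

Lemma reprs_fun_value f t : reprs_fun f t -> lvalue t.
Proof. by case. Qed.

Definition reprs_pair (p : A * B) (t : ltm) : Prop :=
  exists s1 s2, [/\ t = lpair s1 s2, reprs p.1 s1 & reprs p.2 s2].

Lemma reprs_pair_value p t : reprs_pair p t -> lvalue t.
Proof.
case=> s1 [s2 [-> H1 H2]].
by rewrite /= !lvalue_lbound ?(reprs_value H1) ?(reprs_value H2).
Qed.

Fixpoint reprs_seq (l : seq A) (t : ltm) : Prop :=
  match l with
  | [::] => t = lnil
  | a :: l' => exists s1 s2, [/\ t = lcons s1 s2, reprs a s1 & reprs_seq l' s2]
  end.

Lemma reprs_seq_value l t : reprs_seq l t -> lvalue t.
Proof.
elim: l t => [|a l IH] t /=; first by move->.
by case=> s1 [s2 [-> H1 /IH H2]]; rewrite /= !lvalue_lbound ?(reprs_value H1).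
Qed.

End Representations.

Lemma enc_bool_value b t : t = enc_bool b -> lvalue t.
Proof. by move=> ->; case: b. Qed.

Lemma enc_nat_value n t : t = enc_nat n -> lvalue t.
Proof. by move=> ->; elim: n => //= n IH; rewrite lvalue_lbound. Qed.

Lemma enc_term_value s t : t = enc_term s -> lvalue t.
Proof.
move=> ->; elim: s => [x|s IHs s' IHs'|s IHs s' IHs'] /=; rewrite !lvalue_lbound //.
exact: (enc_nat_value (n := x)).
Qed.

#[export] Instance represented_fun A B (RA : represented A) (RB : represented B) :
  represented (A -> B) := Represented (@reprs_fun_value A B RA RB).
#[export] Instance represented_pair A B (RA : represented A) (RB : represented B) :
  represented (A * B) := Represented (@reprs_pair_value A B RA RB).
#[export] Instance represented_seq A (RA : represented A) :
  represented (seq A) := Represented (@reprs_seq_value A RA).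
#[export] Instance represented_bool : represented bool := Represented enc_bool_value.
#[export] Instance represented_nat : represented nat := Represented enc_nat_value.
#[export] Instance represented_term : represented term := Represented enc_term_value.

(** * Combinators for abstraction and application *)

Section Combinators.

Variables (A B C : Type).
Context {RA : represented A} {RB : represented B} {RC : represented C}.

Lemma computable_app0 (f : A -> B) (a : A) :
  computable f -> computable a -> computable (f a).
Proof. by case=> tf [_ Hf] [ta /Hf[v _ Hv]]; exists v. Qed.

Lemma computable_id : computable (@id A).
Proof.
exists (llam (lvar 0)); split=> // a ta Ha; exists ta => //.
have Va := reprs_value Ha; apply: leval_beta => //=; exact: leval_value.
Qed.

Lemma computable_const (b : B) : computable b -> computable (fun _ : A => b).
Proof.
case=> t Ht; have Vt := reprs_value Ht.
exists (llam t); split=> [|a ta Ha]; first by rewrite /= lvalue_lbound.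
exists t => //; apply: leval_beta; first exact: reprs_value Ha.
by rewrite lvalue_lsubst //; exact: leval_value.
Qed.

Lemma computable_app (f : A -> B -> C) (g : A -> B) :
  computable f -> computable g -> computable (fun a => f a (g a)).
Proof.
case=> tf [Vf Hf] [tg [Vg Hg]].
exists (llam (lapp (lapp tf (lvar 0)) (lapp tg (lvar 0)))).
split=> [|a ta Ha]; first by rewrite /= !lvalue_lbound.
have Va := reprs_value Ha; have [vf Ef [Vvf Rf]] := Hf _ _ Ha.
have [vg Eg Rg] := Hg _ _ Ha; have [v Ev Rv] := Rf _ _ Rg; exists v => //.
apply: leval_beta => //=; rewrite !lvalue_lsubst //.
by apply: leval_congr Ev; rewrite ?(reprs_value Rg).
Qed.

(** Reduces two nested abstractions to a single one over a pair. *)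
Lemma computable_curry (f : A -> B -> C) :
  computable (fun p : A * B => f p.1 p.2) -> computable f.
Proof.
(* [lpair] binds a variable itself, so [lvar 2] and [lvar 1] are the outer and the inner
   argument. *)
case=> tf [Vf Hf]; exists (llam (llam (lapp tf (lpair (lvar 2) (lvar 1))))).
split=> [|a ta Ha]; first by rewrite /= lvalue_lbound.
have Va := reprs_value Ha.
have V1 : lvalue (llam (lapp tf (lpair ta (lvar 1)))) by rewrite /= !lvalue_lbound.
exists (llam (lapp tf (lpair ta (lvar 1)))).
  by apply: leval_beta => //=; rewrite lvalue_lsubst //; exact: leval_lam.
split=> // b tb Hb; have Vb := reprs_value Hb.
have [v Ev Rv] := Hf (a, b) (lpair ta tb) (ex_intro _ ta (ex_intro _ tb (And3 erefl Ha Hb))).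
by exists v => //; apply: leval_beta => //=; rewrite !lvalue_lsubst.
Qed.

End Combinators.

Lemma leval_congr_l s t vs v :
  leval s vs -> lvalue vs -> lvalue t -> leval (lapp vs t) v -> leval (lapp s t) v.
Proof. by move=> Hs Vs Vt; apply: leval_congr => //; exact: leval_value. Qed.

Lemma computable_ext A B (RA : represented A) (RB : represented B) (f g : A -> B) :
  f =1 g -> computable f -> computable g.
Proof. by move/functional_extensionality->. Qed.

Lemma computable_ext2 A B C (RA : represented A) (RB : represented B)
    (RC : represented C) (f g : A -> B -> C) :
  f =2 g -> computable f -> computable g.
Proof.
by move=> E; apply: computable_ext => a; apply: functional_extensionality => b; exact: E.
Qed.

Ltac simpl_closed := repeat (progress rewrite /= ?lvalue_lbound ?lvalue_lsubst //).
Ltac lbeta := apply: leval_beta; [simpl_closed | simpl_closed].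

Section Pairs.

Variables (A B : Type).
Context {RA : represented A} {RB : represented B}.

Lemma computable_pair : computable (@pair A B).
Proof.
by apply: computable_curry; apply: computable_ext (computable_id (A := A * B)) => -[].
Qed.

Lemma computable_fst : computable (@fst A B).
Proof.
exists (llam (lapp (lvar 0) (llam (llam (lvar 1))))); split=> // p _ [s1 [s2 [-> H1 H2]]].
have [V1 V2] := (reprs_value H1, reprs_value H2); exists s1 => //.
do 2!lbeta; apply: (leval_congr_l (vs := llam s1)); simpl_closed.
  by lbeta; exact: leval_lam.
by lbeta; exact: leval_value.
Qed.

Lemma computable_snd : computable (@snd A B).
Proof.
exists (llam (lapp (lvar 0) (llam (llam (lvar 0))))); split=> // p _ [s1 [s2 [-> H1 H2]]].
have [V1 V2] := (reprs_value H1, reprs_value H2); exists s2 => //.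
do 2!lbeta; apply: (leval_congr_l (vs := llam (lvar 0))); simpl_closed.
  by lbeta; exact: leval_lam.
by lbeta; exact: leval_value.
Qed.

End Pairs.

(** The conditional as an ordinary function: both branches get evaluated, which is harmless since
    represented functions are total. *)
Definition ifb A (b : bool) (x y : A) : A := if b then x else y.

Lemma computable_ifb A (RA : represented A) : computable (@ifb A).
Proof.
exists (llam (llam (llam (lapp (lapp (lvar 2) (lvar 1)) (lvar 0))))); split=> // b tb Hb.
have Vb := reprs_value Hb.
exists (llam (llam (lapp (lapp tb (lvar 1)) (lvar 0)))); first by lbeta; exact: leval_lam.
split=> [|x tx Hx]; first by simpl_closed.
have Vx := reprs_value Hx.
exists (llam (lapp (lapp tb tx) (lvar 0))); first by lbeta; exact: leval_lam.
split=> [|y ty Hy]; first by simpl_closed.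
have Vy := reprs_value Hy.
exists (if b then tx else ty); last by case: (b).
lbeta; rewrite {}Hb {Vb}; apply: (leval_congr_l (vs := llam (if b then tx else lvar 0))).
- by case: b => /=; lbeta; exact: leval_lam.
- by case: b; simpl_closed.
- by [].
- by case: b; lbeta; exact: leval_value.
Qed.

Lemma computable_true : computable true.
Proof. by exists (enc_bool true). Qed.

Lemma computable_false : computable false.
Proof. by exists (enc_bool false). Qed.

Lemma computable_0 : computable 0.
Proof. by exists (enc_nat 0). Qed.

Lemma computable_S : computable S.
Proof.
exists (llam (llam (llam (lapp (lvar 0) (lvar 2))))); split=> // n _ ->.
have Vn := enc_nat_value (erefl (enc_nat n)).
by exists (enc_nat n.+1) => //; lbeta; exact: leval_lam.
Qed.

(* [natrec_body z s] applied to itself evaluates to the recursor. The arguments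
   [z] and [s] are either closed values or a variable bound outside. *)
Definition natrec_body (z s : ltm) : ltm :=
  llam (llam (lapp (lapp (lvar 0) z)
    (llam (lapp (lapp s (lvar 0)) (lapp (lapp (lvar 2) (lvar 2)) (lvar 0)))))).

Section NatRec.

Variable A : Type.
Context {RA : represented A}.

Definition natrec (z : A) (s : nat -> A -> A) : nat -> A :=
  fix rec n := if n is n'.+1 then s n' (rec n') else z.

(** The self-application [W W] evaluates to the value [R]. The recursive call sits under the
    abstraction [K], so it runs only at a successor and call by value does not loop. *)
Lemma computable_natrec : computable natrec.
Proof.
(* The two arguments [lvar 3] differ: the first ends up under two more binders and denotes [z], the
   second under three and denotes [s]. *)
exists (llam (llam (lapp (natrec_body (lvar 3) (lvar 3)) (natrec_body (lvar 3) (lvar 3))))).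
split=> // z tz Hz; have Vz := reprs_value Hz.
exists (llam (lapp (natrec_body tz (lvar 3)) (natrec_body tz (lvar 3)))).
  by lbeta; exact: leval_lam.
split=> [|s ts [Vs Hs]]; first by simpl_closed.
set W := natrec_body tz ts.
pose K := llam (lapp (lapp ts (lvar 0)) (lapp (lapp W W) (lvar 0))).
pose R := llam (lapp (lapp (lvar 0) tz) K).
have VW : lvalue W by simpl_closed.
have VK : lvalue K by simpl_closed.
have VR : lvalue R by simpl_closed.
have WR : leval (lapp W W) R by lbeta; exact: leval_lam.
exists R; first by lbeta.
split=> // n _ ->; elim: n => [|n [v Ev Rv]].
  exists tz => //; lbeta; rewrite -/K; apply: (leval_congr_l (vs := llam tz)); simpl_closed.
    by lbeta; exact: leval_lam.
  by lbeta; exact: leval_value.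
have Vn := enc_nat_value (erefl (enc_nat n)).
have [vs Es [Vvs Hvs]] := Hs n _ erefl; have [u Eu Ru] := Hvs _ _ Rv; exists u => //.
lbeta; rewrite -/K; apply: (leval_congr_l (vs := llam (lapp (lvar 0) (enc_nat n)))).
- by lbeta; exact: leval_lam.
- by simpl_closed.
- by [].
do 2!lbeta; rewrite -/W; apply: (leval_congr Es _ Vvs (reprs_value Rv) Eu).
by apply: leval_congr_l WR VR Vn Ev.
Qed.

End NatRec.

Section Seq.

Variables A B : Type.
Context {RA : represented A} {RB : represented B}.

Lemma computable_nil : computable (@nil A).
Proof. by exists lnil. Qed.

Lemma computable_cons : computable (@cons A).
Proof.
exists (llam (llam (llam (llam (lapp (lapp (lvar 0) (lvar 3)) (lvar 2)))))).
split=> // a ta Ha; have Va := reprs_value Ha.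
exists (llam (llam (llam (lapp (lapp (lvar 0) ta) (lvar 2))))).
  by lbeta; exact: leval_lam.
split=> [|l tl Hl]; first by simpl_closed.
have Vl := reprs_value Hl; exists (lcons ta tl); last by exists ta, tl.
by lbeta; exact: leval_lam.
Qed.

Definition foldr_body (f z : ltm) : ltm :=
  llam (llam (lapp (lapp (lvar 0) z)
    (llam (llam (lapp (lapp f (lvar 1)) (lapp (lapp (lvar 3) (lvar 3)) (lvar 0))))))).

Lemma computable_foldr : computable (@foldr A B).
Proof.
exists (llam (llam (lapp (foldr_body (lvar 5) (lvar 2)) (foldr_body (lvar 5) (lvar 2))))).
split=> // f tf [Vf Hf].
exists (llam (lapp (foldr_body tf (lvar 2)) (foldr_body tf (lvar 2)))).
  by lbeta; exact: leval_lam.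
split=> [|z tz Hz]; first by simpl_closed.
have Vz := reprs_value Hz.
set W := foldr_body tf tz.
pose K := llam (llam (lapp (lapp tf (lvar 1)) (lapp (lapp W W) (lvar 0)))).
pose R := llam (lapp (lapp (lvar 0) tz) K).
have VW : lvalue W by simpl_closed.
have VK : lvalue K by simpl_closed.
have VR : lvalue R by simpl_closed.
have WR : leval (lapp W W) R by lbeta; exact: leval_lam.
exists R; first by lbeta.
split=> // l; elim: l => [|a l IH] tl /=.
  move=> ->; exists tz => //.
  lbeta; rewrite -/K; apply: (leval_congr_l (vs := llam tz)); simpl_closed.
    by lbeta; exact: leval_lam.
  by lbeta; exact: leval_value.
case=> sa [sl [-> Ha Hl]]; have [v Ev Rv] := IH _ Hl.
have [Va Vl] : lvalue sa /\ lvalue sl := conj (reprs_value Ha) (reprs_seq_value Hl).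
have [vf Ef [Vvf Hvf]] := Hf _ _ Ha; have [u Eu Ru] := Hvf _ _ Rv; exists u => //.
lbeta; rewrite -/K; apply: (leval_congr_l (vs := llam (lapp (lapp (lvar 0) sa) sl))).
- by lbeta; exact: leval_lam.
- by simpl_closed.
- by [].
lbeta; apply: (leval_congr_l (vs := llam (lapp (lapp tf sa) (lapp (lapp W W) (lvar 0))))).
- by lbeta; exact: leval_lam.
- by simpl_closed.
- by [].
lbeta; rewrite -/W; apply: (leval_congr Ef _ Vvf (reprs_value Rv) Eu).
by apply: leval_congr_l WR VR Vl Ev.
Qed.

End Seq.

(** * Constructors and recursor of terms *)

Section Terms.

Lemma computable_Var : computable Var.
Proof.
exists (llam (llam (llam (llam (lapp (lvar 2) (lvar 3)))))); split=> // n _ ->.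
have Vn := enc_nat_value (erefl (enc_nat n)).
by exists (enc_term (Var n)) => //; lbeta; exact: leval_lam.
Qed.

Lemma computable_Add : computable Add.
Proof.
exists (llam (llam (llam (llam (llam (lapp (lapp (lvar 1) (lvar 4)) (lvar 3))))))).
split=> // s _ ->; have Vs := enc_term_value (erefl (enc_term s)).
exists (llam (llam (llam (llam (lapp (lapp (lvar 1) (enc_term s)) (lvar 3)))))).
  by lbeta; exact: leval_lam.
split=> [|t _ ->]; first by simpl_closed.
have Vt := enc_term_value (erefl (enc_term t)).
by exists (enc_term (Add s t)) => //; lbeta; exact: leval_lam.
Qed.

Lemma computable_Mul : computable Mul.
Proof.
exists (llam (llam (llam (llam (llam (lapp (lapp (lvar 0) (lvar 4)) (lvar 3))))))).
split=> // s _ ->; have Vs := enc_term_value (erefl (enc_term s)).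
exists (llam (llam (llam (llam (lapp (lapp (lvar 0) (enc_term s)) (lvar 3)))))).
  by lbeta; exact: leval_lam.
split=> [|t _ ->]; first by simpl_closed.
have Vt := enc_term_value (erefl (enc_term t)).
by exists (enc_term (Mul s t)) => //; lbeta; exact: leval_lam.
Qed.

Variable A : Type.
Context {RA : represented A}.

Definition termrec (v : nat -> A) (a m : term -> term -> A -> A -> A) : term -> A :=
  fix rec t :=
    match t with
    | Var x => v x
    | Add s t => a s t (rec s) (rec t)
    | Mul s t => m s t (rec s) (rec t)
    end.

(** Code for a binary constructor: [a] receives both subterms, then both recursive results; [self]
    is the index of the self-applied body. *)
Definition termrec_branch (a : ltm) (self : nat) : ltm :=
  llam (llam (lapp
    (lapp (lapp (lapp a (lvar 1)) (lvar 0)) (lapp (lapp (lvar self) (lvar self)) (lvar 1)))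
    (lapp (lapp (lvar self) (lvar self)) (lvar 0)))).

Definition termrec_body (v a m : ltm) : ltm :=
  llam (llam (lapp (lapp (lapp (lvar 0) v) (termrec_branch a 3)) (termrec_branch m 3))).

Lemma computable_termrec : computable termrec.
Proof.
pose body v a m := lapp (termrec_body v a m) (termrec_body v a m).
exists (llam (llam (llam (body (lvar 4) (lvar 5) (lvar 4))))).
split=> // v tv Hv; have Vv := reprs_value Hv.
exists (llam (llam (body tv (lvar 5) (lvar 4)))); first by lbeta; exact: leval_lam.
split=> [|a ta [Va Ha]]; first by simpl_closed.
exists (llam (body tv ta (lvar 4))); first by lbeta; exact: leval_lam.
split=> [|m tm [Vm Hm]]; first by simpl_closed.
set W := termrec_body tv ta tm.
pose K c := llam (llam (lapp
  (lapp (lapp (lapp c (lvar 1)) (lvar 0)) (lapp (lapp W W) (lvar 1)))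
  (lapp (lapp W W) (lvar 0)))).
pose R := llam (lapp (lapp (lapp (lvar 0) tv) (K ta)) (K tm)).
have VW : lvalue W by simpl_closed.
have VK c : lvalue c -> lvalue (K c) by move=> Vc; simpl_closed.
have [VKa VKm] := (VK _ Va, VK _ Vm).
have VR : lvalue R by simpl_closed.
have WR : leval (lapp W W) R by lbeta; exact: leval_lam.
exists R; first by lbeta.
(* Sums and products differ only in the code [tc] of their case, so one argument serves both. *)
have branch (c : term -> term -> A -> A -> A) tc s t u1 u2 :
    reprs c tc ->
    leval (lapp R (enc_term s)) u1 -> reprs (termrec v a m s) u1 ->
    leval (lapp R (enc_term t)) u2 -> reprs (termrec v a m t) u2 ->
    exists2 u, leval (lapp (lapp (K tc) (enc_term s)) (enc_term t)) u &
      reprs (c s t (termrec v a m s) (termrec v a m t)) u.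
  move=> [Vc Hc] E1 R1 E2 R2.
  have [Vs Vt] := (enc_term_value (erefl (enc_term s)), enc_term_value (erefl (enc_term t))).
  have [w1 F1 [W1 /(_ t _ erefl)[w2 F2 [W2 /(_ _ _ R1)[w3 F3 [W3 /(_ _ _ R2)[u Eu Ru]]]]]]] :=
    Hc s _ erefl.
  exists u => //.
  apply: (leval_congr_l (vs := llam (lapp
     (lapp (lapp (lapp tc (enc_term s)) (lvar 0)) (lapp (lapp W W) (enc_term s)))
     (lapp (lapp W W) (lvar 0))))).
  - by lbeta; exact: leval_lam.
  - by simpl_closed.
  - by [].
  lbeta; rewrite -/W; apply: (leval_congr _ _ W3 (reprs_value R2) Eu).
    apply: (leval_congr _ _ W2 (reprs_value R1) F3).
      by apply: (leval_congr_l F1).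
    by apply: leval_congr_l WR VR Vs E1.
  by apply: leval_congr_l WR VR Vt E2.
split=> // t _ ->; elim: t => [x|s [u1 E1 R1] t [u2 E2 R2]|s [u1 E1 R1] t [u2 E2 R2]].
- have Vx := enc_nat_value (erefl (enc_nat x)).
  have [Vv' /(_ x _ erefl)[u Eu Ru]] := Hv; exists u => //.
  lbeta; rewrite -/(K ta) -/(K tm).
  apply: (leval_congr_l (vs := llam (lapp tv (enc_nat x)))); simpl_closed; last by lbeta.
  apply: (leval_congr_l (vs := llam (llam (lapp tv (enc_nat x))))); simpl_closed.
    by lbeta; exact: leval_lam.
  by lbeta; exact: leval_lam.
- have [Vs Vt] := (enc_term_value (erefl (enc_term s)), enc_term_value (erefl (enc_term t))).
  have [u Eu Ru] := branch a ta s t u1 u2 (conj Va Ha) E1 R1 E2 R2; exists u => //.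
  lbeta; rewrite -/(K ta) -/(K tm).
  apply: (leval_congr_l
    (vs := llam (lapp (lapp (K ta) (enc_term s)) (enc_term t)))); simpl_closed.
  - apply: (leval_congr_l
      (vs := llam (llam (lapp (lapp (lvar 1) (enc_term s)) (enc_term t))))); simpl_closed.
      by lbeta; exact: leval_lam.
    by lbeta; exact: leval_lam.
  - by lbeta.
- have [Vs Vt] := (enc_term_value (erefl (enc_term s)), enc_term_value (erefl (enc_term t))).
  have [u Eu Ru] := branch m tm s t u1 u2 (conj Vm Hm) E1 R1 E2 R2; exists u => //.
  lbeta; rewrite -/(K ta) -/(K tm).
  apply: (leval_congr_l
    (vs := llam (lapp (lapp (lvar 0) (enc_term s)) (enc_term t)))); simpl_closed.
  - apply: (leval_congr_l
      (vs := llam (llam (lapp (lapp (lvar 0) (enc_term s)) (enc_term t))))); simpl_closed.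
      by lbeta; exact: leval_lam.
    by lbeta; exact: leval_lam.
  - by lbeta.
Qed.

End Terms.

(* Compilation of the decision procedure *)
Create HintDb computable.
#[local] Hint Resolve computable_pair computable_fst computable_snd computable_ifb
  computable_true computable_false computable_0 computable_S computable_natrec
  computable_nil computable_cons computable_foldr computable_Var computable_Add
  computable_Mul computable_termrec : computable.

(* Bracket abstraction over the constants known to be computable. *)
Ltac compile :=
  cbv beta;
  lazymatch goal with
  | |- computable (fun _ => ?b) => apply: computable_const; compile
  | |- computable (fun x => x) => exact: computable_id
  | |- computable (fun x => fun y => @?b x y) =>
      apply: computable_curry; compile
  | |- computable (fun x : ?T => @?b x) =>
      let f := constr:(fun x : T => ltac:(
        let t := eval cbv beta in (b x) in lazymatch t with ?f _ => exact f end)) in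
      let a := constr:(fun x : T => ltac:(
        let t := eval cbv beta in (b x) in lazymatch t with _ ?a => exact a end)) in
      apply: (computable_app (f := f) (g := a)); compile
  | |- computable ?c =>
      first [ assumption | solve [auto 1 with computable]
            | lazymatch c with ?f ?a => apply: (@computable_app0 _ _ _ _ f a); compile end ]
  end.

Lemma computable_addn : computable addn.
Proof.
apply: (computable_ext2 (f := fun m n => natrec n (fun _ => S) m)); last by compile.
by move=> m n; elim: m => //= m ->.
Qed.
#[local] Hint Resolve computable_addn : computable.

Lemma computable_muln : computable muln.
Proof.
apply: (computable_ext2 (f := fun m n => natrec 0 (fun _ => addn n) m)); last by compile.
by move=> m n; elim: m => //= m ->.
Qed.
#[local] Hint Resolve computable_muln : computable.

Lemma computable_expn : computable expn.
Proof.
apply: (computable_ext2 (f := fun m n => natrec 1 (fun _ => muln m) n)); last by compile.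
by move=> m n; elim: n => //= n ->; rewrite expnS.
Qed.
#[local] Hint Resolve computable_expn : computable.

(** Recursion on the first number returns a predicate on the second, so both descend together. *)
Lemma computable_eqn : computable eqn.
Proof.
apply: (computable_ext2 (f := natrec (fun n => natrec true (fun _ _ => false) n)
  (fun _ r n => natrec false (fun k _ => r k) n))); last by compile.
by elim=> [|m IH] [|n] //=.
Qed.
#[local] Hint Resolve computable_eqn : computable.

Lemma computable_andb : computable andb.
Proof. by apply: (computable_ext2 (f := fun a b => ifb a b false)); last by compile. Qed.
#[local] Hint Resolve computable_andb : computable.

Lemma computable_orb : computable orb.
Proof. by apply: (computable_ext2 (f := fun a b => ifb a true b)); last by compile. Qed.
#[local] Hint Resolve computable_orb : computable.

Section SeqPrograms.

Variables A B : Type.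
Context {RA : represented A} {RB : represented B}.

Lemma computable_map : computable (@map A B).
Proof.
apply: (computable_ext2 (f := fun f => foldr (fun a => cons (f a)) nil)); last by compile.
by move=> f; elim=> //= a l ->.
Qed.

Lemma computable_cat : computable (@cat A).
Proof.
apply: (computable_ext2 (f := fun s t => foldr cons t s)); last by compile.
by move=> s t; elim: s => //= a s ->.
Qed.

Lemma computable_all : computable (@all A).
Proof.
apply: (computable_ext2 (f := fun a => foldr (fun x => andb (a x)) true)); last by compile.
by move=> a; elim=> //= x s ->.
Qed.

Lemma computable_has : computable (@has A).
Proof.
apply: (computable_ext2 (f := fun a => foldr (fun x => orb (a x)) false)); last by compile.
by move=> a; elim=> //= x s ->.
Qed.

Lemma computable_nth : computable (@nth A).
Proof.
apply: (computable_ext2 (f := fun x0 s =>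
  foldr (fun x r n => natrec x (fun k _ => r k) n) (fun _ => x0) s)); last by compile.
move=> x0 s; apply: functional_extensionality.
by elim: s => [|x s IH] [|n] //=; rewrite -IH.
Qed.

End SeqPrograms.
#[local] Hint Resolve computable_map computable_cat computable_all computable_has
  computable_nth : computable.

Lemma computable_flatten A (RA : represented A) : computable (@flatten A).
Proof. by rewrite /flatten; compile. Qed.
#[local] Hint Resolve computable_flatten : computable.

Lemma computable_distr : computable distr.
Proof.
apply: (computable_ext2 (f := fun s => termrec (fun x => Mul s (Var x)) (fun _ _ => Add)
  (fun t1 t2 _ _ => Mul s (Mul t1 t2)))); last by compile.
by move=> s; elim=> //= t1 -> t2 ->.
Qed.
#[local] Hint Resolve computable_distr : computable.

Lemma computable_nf : computable nf.
Proof.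
apply: (computable_ext (f := termrec Var (fun _ _ => Add) (fun _ _ => distr)));
  last by compile.
by elim=> //= s -> t ->.
Qed.
#[local] Hint Resolve computable_nf : computable.

Lemma computable_subst : computable subst.
Proof.
apply: (computable_ext2 (f := fun d => termrec d (fun _ _ => Add) (fun _ _ => Mul)));
  last by compile.
by move=> d; elim=> //= s -> t ->.
Qed.
#[local] Hint Resolve computable_subst : computable.

Lemma computable_term_size : computable term_size.
Proof.
apply: (computable_ext (f := termrec S (fun _ _ m n => (m + n).+1)
  (fun _ _ m n => (m + n).+1))); last by compile.
by elim=> //= s -> t ->.
Qed.
#[local] Hint Resolve computable_term_size : computable.

(** The outer recursion returns predicates: [r1] and [r2] test equality with the two subterms of the
    first term. *)
Lemma computable_eqterm : computable eqterm.
Proof.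
pose no : term -> term -> bool -> bool -> bool := fun _ _ _ _ => false.
apply: (computable_ext2 (f := termrec (fun x => termrec (eqn x) no no)
  (fun _ _ r1 r2 => termrec (fun _ => false) (fun t1 t2 _ _ => r1 t1 && r2 t2) no)
  (fun _ _ r1 r2 => termrec (fun _ => false) no (fun t1 t2 _ _ => r1 t1 && r2 t2)))).
  by elim=> [x|s1 IH1 s2 IH2|s1 IH1 s2 IH2] [y|t1 t2|t1 t2] //=; rewrite IH1 IH2.
by rewrite /no; compile.
Qed.
#[local] Hint Resolve computable_eqterm : computable.

Lemma computable_solves : computable solves.
Proof. by rewrite /solves; compile. Qed.
#[local] Hint Resolve computable_solves : computable.

Lemma computable_small_terms : computable small_terms.
Proof.
apply: (computable_ext (f := natrec [:: Var 0] (fun _ T => Var 0 ::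
  flatten [seq [seq Add a b | b <- T] | a <- T] ++
  flatten [seq [seq Mul a b | b <- T] | a <- T]))); last by compile.
by elim=> //= n ->.
Qed.
#[local] Hint Resolve computable_small_terms : computable.

Lemma computable_tuples : computable tuples.
Proof.
apply: (computable_ext2 (f := fun T => natrec [:: [::]]
  (fun _ L => flatten [seq [seq t :: l | l <- L] | t <- T]))); last by compile.
by move=> T; elim=> //= n ->.
Qed.
#[local] Hint Resolve computable_tuples : computable.

Lemma computable_problem_size : computable problem_size.
Proof. by rewrite /problem_size /equation_size; compile. Qed.
#[local] Hint Resolve computable_problem_size : computable.

Lemma computable_depth_bound : computable depth_bound.
Proof. by rewrite /depth_bound; compile. Qed.
#[local] Hint Resolve computable_depth_bound : computable.

Lemma computable_unifiable : computable unifiable.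
Proof. by rewrite /unifiable /seq_subst; compile. Qed.

Lemma reprs_problem (P : problem) : reprs P (enc_problem P).
Proof.
elim: P => //= -[s t] P IH; exists (enc_equation (s, t)), (enc_problem P); split=> //.
by exists (enc_term s), (enc_term t).
Qed.

Theorem theorem7p9 : decidable_by_algorithm enc_problem asym_unifiable.
Proof.
have [u [Vu Hu]] := computable_unifiable.
exists u; first exact: lvalue_lbound.
move=> P; have [v Ev Rv] := Hu P _ (reprs_problem P).
(* The only representative of a boolean is its encoding, so the output has the required form. *)
rewrite (Rv : v = enc_bool _) in Ev.
by exists (unifiable P); split=> //; exact: unifiableP.
Qed.
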